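(* Let $\mathcal{X}$ be a complex Banach space with $\dim \mathcal{X} \geq 3$. Suppose $\phi:\mathcal{B}(\mathcal{X})\to \mathcal{B}(\mathcal{X})$ is a surjective linear map such that $F(A)=F(\phi(A))$ for all $A\in \mathcal{B}(\mathcal{X})$. Then $\phi(A)=A$ for all $A\in \mathcal{B}(\mathcal{X})$.
   Context: $\mathcal{B}(\mathcal{X})$ denotes the algebra of all bounded linear operators on $\mathcal{X}$. For $T\in\mathcal{B}(\mathcal{X})$, $F(T)=\{x\in\mathcal{X} : Tx=x\}$ denotes the vector space of all fixed points of $T$. The map $\phi$ is not assumed to be continuous or multiplicative. *)

(* Defs.v *)
From HB Require Import structures.
From mathcomp Require Import all_boot all_order all_algebra.
From mathcomp Require Import all_classical all_reals all_analysis.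
From mathcomp Require Export complex.
Set Implicit Arguments.
Unset Strict Implicit.
Unset Printing Implicit Defensive.
Import Order.TTheory GRing.Theory Num.Theory.
Import numFieldNormedType.Exports.
Local Open Scope classical_set_scope.
Local Open Scope ring_scope.

(* [dim V >= n] for a space that may be infinite-dimensional, where the
   library's [\dim] and [free], which need a [vectType], do not apply. *)
Definition linearly_independent (K : fieldType) (V : lmodType K) (n : nat)
    (e : 'I_n -> V) : Prop :=
  forall c : 'I_n -> K, \sum_(i < n) c i *: e i = 0 -> forall i, c i = 0.

Definition dim_ge (K : fieldType) (V : lmodType K) (n : nat) : Prop :=
  exists e : 'I_n -> V, linearly_independent e.

Section BoundedOperators.
Variables (K : numFieldType) (V : normedModType K).

Definition bounded_linear (f : V -> V) : Prop :=
  linear f /\ exists M : K, forall x, `|f x| <= M * `|x|.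

Definition bounded_linear_pred : {pred V -> V} :=
  [pred f | `[< bounded_linear f >]].

(* B(V) as a vector space over K, with the pointwise operations inherited from
   [V -> V]; the product (composition) is not needed. *)
Record bounded_op : Type := BoundedOp {
  bounded_op_fun :> V -> V;
  _ : bounded_op_fun \in bounded_linear_pred }.

HB.instance Definition _ := [isSub for bounded_op_fun].
HB.instance Definition _ := [Choice of bounded_op by <:].

Lemma bounded_linear_submod_closed : submod_closed bounded_linear_pred.
Proof.
split.
  apply/asboolP; split; first by move=> a x y; rewrite /= scaler0 addr0.
  by exists 0 => x; rewrite /= mul0r normr0.
move=> a f g /asboolP[lf [M fM]] /asboolP[lg [N gN]]; apply/asboolP; split.
  move=> b x y; rewrite !fctE lf lg !scalerDr !scalerA (mulrC a b).
  by rewrite addrACA.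
exists (`|a| * M + N) => x; rewrite !fctE mulrDl.
rewrite (le_trans (ler_normD _ _))// lerD// normrZ -mulrA.
exact: ler_wpM2l.
Qed.

HB.instance Definition _ := GRing.isSubmodClosed.Build K (V -> V)
  bounded_linear_pred bounded_linear_submod_closed.
HB.instance Definition _ := [SubChoice_isSubLmodule of bounded_op by <:].

Lemma bounded_opP (A : bounded_op) : bounded_linear A.
Proof. by case: A => f /= /asboolP. Qed.

HB.instance Definition _ (A : bounded_op) :=
  GRing.isLinear.Build K V V *:%R (bounded_op_fun A) (bounded_opP A).1.

Lemma bounded_op_ext (A B : bounded_op) : A =1 B -> A = B.
Proof. by move=> AB; apply/val_inj/funext. Qed.

Lemma bounded_opD (A B : bounded_op) (x : V) : (A + B) x = A x + B x.
Proof. by []. Qed.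

Lemma bounded_opZ (a : K) (A : bounded_op) (x : V) : (a *: A) x = a *: A x.
Proof. by []. Qed.

Definition fixed_points (A : bounded_op) : set V := [set x | A x = x].

End BoundedOperators.

(* Main.v *)
(* Since phi fixes the identity, translating by multiples of it turns
   preservation of fixed points into preservation of every eigenvector. For a
   rank-one operator A = f(.) u with f u <> 0, the line through u and ker f span
   the space, so phi A = A; if f u = 0, write u = (u + x) - x with f x = 1.
   For arbitrary A and x <> 0, choose f with f x = 1: then A - f(.) (A x) kills
   x, hence so does its image, and phi A x = A x. Only the existence of f
   requires analysis, namely the Hahn-Banach theorem, obtained here from a
   minimal sublinear functional, which avoids partially defined functionals. *)
Require Import Defs.
From HB Require Import structures.
From mathcomp Require Import all_boot all_order all_algebra.
From mathcomp Require Import all_classical all_reals all_analysis.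
From mathcomp Require Import complex.
From mathcomp Require Import ring lra.
Set Implicit Arguments.
Unset Strict Implicit.
Unset Printing Implicit Defensive.
Import Order.TTheory GRing.Theory Num.Theory.
Import numFieldNormedType.Exports.
Local Open Scope classical_set_scope.
Local Open Scope ring_scope.

(** * Hahn-Banach over the reals, by minimal sublinear functionals *)

Section HahnBanach.
Variables (R : realType) (V : lmodType R).
Implicit Types (p q : V -> R) (x y a : V).

(** Homogeneity is asked as an inequality, the form that passes to infima; applying it to [t^-1]
    gives equality. *)
Definition sublinear p :=
  (forall x y, p (x + y) <= p x + p y) /\
  (forall t x, 0 < t -> p (t *: x) <= t * p x).

Lemma sublinearZ p t x : sublinear p -> 0 <= t -> p (t *: x) = t * p x.
Proof.
move=> [_ pZ]; have pZE s y : 0 < s -> p (s *: y) = s * p y.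
  move=> s0; apply/eqP; rewrite eq_le pZ//= mulrC -ler_pdivlMr// mulrC.
  by rewrite -{1}(scalerK (lt0r_neq0 s0) y) pZ// invr_gt0.
rewrite le_eqVlt => /predU1P[<-|/pZE//]; rewrite scale0r mul0r.
have := pZE 2 0 (ltr0n _ 2); rewrite scaler0; lra.
Qed.

Lemma sublinear0 p : sublinear p -> p 0 = 0.
Proof. by move=> sp; rewrite -(scale0r 0) sublinearZ// mul0r. Qed.

Lemma sublinear_geN p x : sublinear p -> - p (- x) <= p x.
Proof.
move=> sp; have := sp.1 x (- x); rewrite subrr sublinear0//; lra.
Qed.

(** The pointwise infimum works, [m] keeping it finite. As [h] may depend on the points, this covers
    chains as well as one-parameter families. *)
Lemma sublinear_inf (F : set (V -> R)) (m : V -> R) : F !=set0 ->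
  (forall f, F f -> forall x, m x <= f x) ->
  (forall f g x y, F f -> F g -> exists2 h, F h & h (x + y) <= f x + g y) ->
  (forall f t x, 0 < t -> F f -> exists2 h, F h & h (t *: x) <= t * f x) ->
  exists2 q, sublinear q & forall f, F f -> forall x, q x <= f x.
Proof.
move=> [f0 Ff0] mF FD FZ; pose q x := inf [set f x | f in F].
have qF f x : F f -> q x <= f x.
  move=> Ff; apply: ge_inf; last by exists f.
  by exists (m x) => _ [g Fg <-]; exact: mF.
have qlb x c : (forall f, F f -> c <= f x) -> c <= q x.
  move=> cF; apply: lb_le_inf; first by exists (f0 x), f0.
  by move=> _ [g Fg <-]; exact: cF.
exists q => [|f Ff x]; last exact: qF.
split=> [x y|t x t0].
  rewrite -lerBlDr; apply: (qlb) => f Ff.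
  rewrite lerBlDr -lerBlDl; apply: (qlb) => g Fg; rewrite lerBlDl.
  by have [h /qF/le_trans + hfg] := FD f g x y Ff Fg; apply.
rewrite -ler_pdivrMl//; apply: (qlb) => f Ff; rewrite ler_pdivrMl//.
by have [h /qF/le_trans + hf] := FZ f t x t0 Ff; apply.
Qed.

(** Take the infimum over [t >= 0] of [q (x + t *: a) - t * q a]: [t = 0] gives [r <= q], and
    [t = 1] gives the bound at [- a]. *)
Lemma sublinear_lower q a : sublinear q ->
  exists2 r, sublinear r & (forall x, r x <= q x) /\ r (- a) <= - q a.
Proof.
move=> sq; have [qD qZ] := sq.
pose F := [set (fun x => q (x + t *: a) - t * q a) | t in [set t | 0 <= t]].
have [||||r sr rF] := @sublinear_inf F (fun x => - q (- x)).
- by eexists; exists 0 => //=.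
(* Lower bound: [t * q a = q (t *: a) <= q (x + t *: a) + q (- x)]. *)
- move=> _ [t /= t0 <-] x; rewrite lerBrDl -(sublinearZ _ sq t0) lerBlDr.
  by rewrite (le_trans _ (qD _ _))// addrAC subrr add0r.
- move=> _ _ x y [t /= t0 <-] [s /= s0 <-].
  eexists; first by exists (t + s) => //=; exact: addr_ge0.
  rewrite /= scalerDl [x + y + _]addrACA [leRHS]addrACA mulrDl -opprD lerD2r.
  exact: qD.
- move=> _ s x s0 [t /= t0 <-].
  eexists; first by exists (s * t) => //=; rewrite mulr_ge0// ltW.
  by rewrite /= -scalerA -scalerDr mulrBr mulrA lerD2r qZ.
exists r => //; split=> [x|].
  have /rF/(_ x) : F (fun x => q (x + 0 *: a) - 0 * q a) by exists 0 => /=.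
  by rewrite scale0r addr0 mul0r subr0.
have /rF/(_ (- a)) : F (fun x => q (x + 1 *: a) - 1 * q a).
  by exists 1 => //=.
by rewrite scale1r addNr mul1r sublinear0// sub0r.
Qed.

Lemma minimal_sublinear p : sublinear p ->
  exists q, [/\ sublinear q, forall x, q x <= p x &
    forall r, sublinear r -> (forall x, r x <= q x) -> forall x, q x <= r x].
Proof.
move=> sp; pose T := {q : V -> R | sublinear q /\ forall x, q x <= p x}.
(* The order is reversed, so that Zorn's maximal element is a minimal functional. *)
pose le_op (f g : T) := `[< forall x, sval g x <= sval f x >].
have [|||] := @ZL_preorder T (exist _ p (conj sp (fun=> lexx _))) le_op.
- by move=> t; apply/asboolP.
- move=> g f h /asboolP fg /asboolP gh; apply/asboolP => x.
  exact: le_trans (gh x) (fg x).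
- move=> A totA; have [[f0 Af0]|A0] := pselect (A !=set0); last first.
    by exists (exist _ p (conj sp (fun=> lexx _))) => s As; case: A0; exists s.
  have [||||q sq qA] := @sublinear_inf (sval @` A) (fun x => - p (- x)).
  + by exists (sval f0), f0.
  + move=> _ [[f [sf fp]] Af <-] x /=.
    by rewrite (le_trans _ (sublinear_geN x sf))// lerN2.
  + move=> _ _ x y [f Af <-] [g Ag <-].
    (* In a chain, the smaller of [f] and [g] serves as [h]. *)
    have [/asboolP fg|/asboolP gf] := totA _ _ Af Ag.
      exists (sval g); first by exists g.
      by rewrite (le_trans ((svalP g).1.1 _ _))// lerD2r.
    exists (sval f); first by exists f.
    by rewrite (le_trans ((svalP f).1.1 _ _))// lerD2l.
  + move=> _ t x t0 [f Af <-]; exists (sval f); first by exists f.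
    exact: (svalP f).1.2.
  have qp x : q x <= p x.
    rewrite (le_trans (qA (sval f0) _ x)) ?(svalP f0).2//; by exists f0.
  exists (exist _ q (conj sq qp)) => s As; apply/asboolP => x /=.
  by apply: qA; exists s.
- move=> [q [sq qp]] qmin; exists q; split=> // r sr rq x.
  have rp y : r y <= p y by rewrite (le_trans (rq y)).
  have /asboolP := qmin (exist _ r (conj sr rp)) (introT (asboolP _) rq).
  exact.
Qed.

(* A minimal sublinear functional is linear, as [sublinear_lower] cannot decrease
   it. Lowering [p] at [a] beforehand forces the value at [a]. *)
Lemma hahn_banach p a : sublinear p ->
  exists g : V -> R, [/\ scalar g, forall x, g x <= p x & g a = p a].
Proof.
move=> sp; have [r sr [rp ra]] := sublinear_lower a sp.
have [g [sg gr gmin]] := minimal_sublinear sr.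
(* Minimality gives [g <= s] for the functional [s] lowered at [x], so
   [g (- x) <= s (- x) <= - g x]. *)
have gN x : g (- x) = - g x.
  have [s ss [sg' sx]] := sublinear_lower x sg.
  apply/le_anti; rewrite (le_trans (gmin s ss sg' _) sx)/=.
  by have := sublinear_geN (- x) sg; rewrite opprK.
(* Superadditivity: [g x <= g (x + y) + g (- y)], and [g] is odd. *)
have gD x y : g (x + y) = g x + g y.
  apply/le_anti; rewrite sg.1/= -lerBrDr -gN.
  by rewrite (le_trans _ (sg.1 _ _))// addrK.
exists g; split=> [t x y|x|].
- rewrite gD; congr (_ + _); have [t0|t0] := leP 0 t; first exact: sublinearZ.
  rewrite -[t]opprK scaleNr gN sublinearZ ?mulNr// oppr_ge0; exact: ltW.
- exact: le_trans (gr x) (rp x).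
- apply/le_anti; rewrite (le_trans (gr a) (rp a))/=.
  by rewrite -lerN2 -gN (le_trans (gr _) ra).
Qed.

End HahnBanach.

(** * Complex spaces as real ones, under an alias that keeps the two scalings apart *)

Definition realification (R : rcfType) (V : lmodType R[i]) : Type := V.

Section Realification.
Local Open Scope complex_scope.
Variables (R : rcfType) (V : lmodType R[i]).

HB.instance Definition _ := GRing.Zmodule.on (realification V).

Let scale (t : R) (x : realification V) : realification V :=
  (t%:C *: (x : V) : V).

Let scaleA t s x : scale t (scale s x) = scale (t * s) x.
Proof. by rewrite /scale scalerA rmorphM. Qed.

Let scale1 : left_id 1 scale.
Proof. by move=> x; rewrite /scale rmorph1 scale1r. Qed.

Let scaleDr : right_distributive scale +%R.
Proof. by move=> t x y; rewrite /scale scalerDr. Qed.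

Let scaleDl x : {morph scale^~ x : t s / t + s}.
Proof. by move=> t s; rewrite /scale rmorphD scalerDl. Qed.

HB.instance Definition _ := GRing.Zmodule_isLmodule.Build R (realification V)
  scaleA scale1 scaleDr scaleDl.

Lemma realification_scaleE (t : R) (x : realification V) :
  t *: x = (t%:C *: (x : V) : V).
Proof. by []. Qed.

End Realification.

(** * Bounded complex functionals *)

Section BoundedFunctional.
Local Open Scope complex_scope.
Variables (R : realType) (X : normedModType R[i]).

Lemma bounded_functional (a : X) : a != 0 ->
  exists f : X -> R[i], [/\ scalar f,
    exists M, forall x, `|f x| <= M * `|x| & f a = 1].
Proof.
move=> a0; pose V := realification X.
(* The norm takes values in [R[i]]; its real part is the same number in [R]. *)
pose p (x : V) := complex.Re `|x : X|.
have pE x : (p x)%:C = `|x : X| by rewrite /p RRe_real// normr_real.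
have sp : sublinear p.
  split=> [x y|t x t0].
    by rewrite -lecR rmorphD /= !pE ler_normD.
  rewrite -lecR rmorphM/= !pE realification_scaleE normrZ ger0_norm//.
  by rewrite ler0c ltW.
have [g [glin gp ga]] := hahn_banach (a : V) sp.
have gD x y : g (x + y : X) = g x + g y by have := glin 1 x y; rewrite scale1r mul1r.
have g0 : g (0 : X) = 0 by have := gD 0 0; rewrite addr0; lra.
have gZ t (x : X) : g (t%:C *: x) = t * g x.
  by have := glin t x 0; rewrite !addr0 g0 addr0.
have gN (x : X) : g (- x) = - g x by have := gD x (- x); rewrite subrr g0; lra.
(* The usual complexification: the complex-linear functional with real part [g]. *)
pose h (x : X) : R[i] := g x -i* g ('i *: x).
have hD x y : h (x + y) = h x + h y.
  by rewrite /h scalerDr !gD; apply/eqP; rewrite eq_complex/= opprD !eqxx.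
have hZr t x : h (t%:C *: x) = t%:C * h x.
  rewrite /h scalerA (mulrC 'i) -scalerA !gZ; apply/eqP; rewrite eq_complex/=.
  by apply/andP; split; apply/eqP; ring.
have hZi x : h ('i *: x) = 'i * h x.
  rewrite /h scalerA -expr2 sqr_i scaleN1r gN; apply/eqP; rewrite eq_complex/=.
  by apply/andP; split; apply/eqP; ring.
have hlin : scalar h.
  move=> c x y; rewrite hD [c]complexE scalerDl hD -scalerA hZi !hZr mulrDl.
  by rewrite mulrA.
have gle x : `|g x|%:C <= `|x|.
  rewrite -pE lecR ler_norml gp andbT -[g x]opprK -gN lerN2 (le_trans (gp _))//.
  by rewrite -lecR !pE normrN.
(* The constant [2] comes from bounding the real and imaginary parts separately. *)
have hle x : `|h x| <= 2 * `|x|.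
  have -> : h x = (g x)%:C - 'i * (g ('i *: x))%:C.
    by rewrite [h x]complexE /= rmorphN mulrN.
  have normR (t : R) : `|t%:C| = `|t|%:C.
    by rewrite normc_def /= expr0n addr0 sqrtr_sqr.
  have normi : `|'i : R[i]| = 1.
    by rewrite normc_def /= expr0n add0r expr1n sqrtr1.
  rewrite (le_trans (ler_normB _ _))// mulr2n mulrDl mul1r lerD ?normR//.
  by rewrite normrM normi mul1r normR (le_trans (gle _))// normrZ normi mul1r.
(* The real part of [h a] is [g a = p a], the norm of [a]. *)
have ha0 : h a != 0.
  apply/eqP => /(congr1 (@complex.Re R)) /= ga0; move: a0.
  by rewrite -normr_eq0 -pE -ga ga0 eqxx.
exists (fun x => (h a)^-1 * h x); split.
- by move=> c x y; rewrite hlin mulrDr mulrCA.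
- exists (`|h a|^-1 * 2) => x; rewrite normrM normfV -mulrA.
  by rewrite ler_wpM2l// invr_ge0.
- by rewrite mulVf.
Qed.

End BoundedFunctional.

(** * Fixed-point preservers on eigenvectors and rank-one operators *)

Section RankOne.
Variables (K : numFieldType) (V : normedModType K).

Lemma bounded_linear_id : @id V \in @bounded_linear_pred K V.
Proof. by apply/asboolP; split=> //; exists 1 => x; rewrite mul1r. Qed.

Definition id_op : bounded_op V := BoundedOp bounded_linear_id.

Lemma rank_one_op (f : V -> K) (u : V) : scalar f ->
  (exists M, forall x, `|f x| <= M * `|x|) ->
  exists A : bounded_op V, forall x, A x = f x *: u.
Proof.
move=> flin [M fM]; suff fu : (fun x => f x *: u) \in @bounded_linear_pred K V.
  by exists (BoundedOp fu).
apply/asboolP; split=> [c x y|]; first by rewrite flin scalerDl scalerA.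
exists (M * `|u|) => x; rewrite normrZ mulrAC; exact: ler_wpM2r.
Qed.

Variable phi : {linear bounded_op V -> bounded_op V}.
Hypothesis phi_fix : forall A, fixed_points A `<=` fixed_points (phi A).

(** Both [A + (1 - l) *: id_op] and [id_op] fix [x], hence so do their images; subtract. *)
Lemma fix_preserver_eigen (A : bounded_op V) l x : A x = l *: x -> phi A x = l *: x.
Proof.
move=> Ax; have phi1 : phi id_op x = x by exact: (phi_fix (A := id_op)).
have fixA : (A + (1 - l) *: id_op) x = x.
  by rewrite bounded_opD bounded_opZ Ax -scalerDl addrC subrK scale1r.
have /= := phi_fix fixA; rewrite /fixed_points/mkset linearD linearZ.
rewrite bounded_opD bounded_opZ phi1 => /(canRL (addrK _)) ->.
by rewrite scalerBl scale1r opprB addrC subrK.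
Qed.

Lemma fix_preserver_rank_one (f : V -> K) (u x : V) (A : bounded_op V) :
  scalar f -> (exists M, forall x, `|f x| <= M * `|x|) ->
  (forall y, A y = f y *: u) -> f x = 1 -> phi A x = u.
Proof.
move=> flin fM; have f0 : f 0 = 0.
  by have := flin (-1) 0 0; rewrite scaler0 addr0 mulN1r addNr.
have fD y z : f (y + z) = f y + f z.
  by have := flin 1 y z; rewrite scale1r mul1r.
have fZ c y : f (c *: y) = c * f y by have := flin c y 0; rewrite !addr0 f0 addr0.
(* Split [x] into [(f v)^-1 *: v] and a vector of the kernel of [f]: eigenvectors of [B] for [f v]
   and [0]. *)
have transverse (B : bounded_op V) v : (forall y, B y = f y *: v) ->
    f v != 0 -> f x = 1 -> phi B x = v.
  move=> BE fv fx; have Bv : phi B v = f v *: v by exact: fix_preserver_eigen.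
  have Bk : phi B (x - (f v)^-1 *: v) = 0.
    rewrite (@fix_preserver_eigen B 0) ?scale0r// BE fD -scaleNr fZ fx mulNr.
    by rewrite mulVf// subrr scale0r.
  rewrite -[x](subrK ((f v)^-1 *: v)) linearD /= Bk add0r linearZ /= Bv.
  by rewrite scalerA mulVf// scale1r.
move=> AE fx; have [fu|fu] := eqVneq (f u) 0; last exact: transverse.
(* With [B = f(.) x], both [A + B] and [B] are transverse, so [phi A x = (u + x) - x]. *)
have [B BE] := rank_one_op x flin fM.
have ABE y : (A + B) y = f y *: (u + x) by rewrite bounded_opD AE BE scalerDr.
have fux : f (u + x) != 0 by rewrite fD fu fx add0r oner_eq0.
have := transverse _ _ ABE fux fx.
rewrite linearD bounded_opD (transverse B x)// ?fx ?oner_eq0// => /addIr; exact.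
Qed.

End RankOne.

Theorem theorem1p1 (R : realType) (X : completeNormedModType R[i])
    (hdim : dim_ge X 3)
    (phi : {linear bounded_op X -> bounded_op X})
    (phi_surj : set_surj [set: bounded_op X] [set: bounded_op X] phi)
    (phi_fix : forall A : bounded_op X, fixed_points A = fixed_points (phi A)) :
  forall A : bounded_op X, phi A = A.
Proof.
move=> A; apply: bounded_op_ext => x.
have [->|x0] := eqVneq x 0; first by rewrite !linear0.
have fixS B : fixed_points B `<=` fixed_points (phi B) by rewrite -phi_fix.
have [f [flin fM fx]] := bounded_functional x0.
(* [B] is a rank-one operator that agrees with [A] at [x]. *)
have [B BE] := rank_one_op (A x) flin fM.
have : phi (A - B) x = 0 *: x.
  apply: fix_preserver_eigen => //.
  by rewrite bounded_opD [(- B) x]/(- B x) BE fx !scale1r subrr scale0r.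
rewrite linearB scale0r => /eqP; rewrite subr_eq0 => /eqP ->.
exact: fix_preserver_rank_one BE fx.
Qed.
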